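(* Let $(W,S)$ be a finite irreducible Coxeter system, let $w\in W$, and let $u,v\in\mathcal{R}(w)$ be two reduced words for $w$ that are related by a sequence of $k$ commutations (i.e. braid moves of length $2$). Then the $S$-sign function $\sigma$ and the $T$-sign function $\tau$ satisfy \[ \sigma(u)=(-1)^k\sigma(v)\qquad\text{and}\qquad \tau(u)=(-1)^k\tau(v). \]
   Context: $S=\{s_1<s_2<\dots<s_n\}$ is a totally ordered alphabet, $(m_{i,j})$ is the Coxeter matrix of $(W,S)$, and $\mathcal{R}(w)$ is the set of reduced words of $w$ (words in $S$ of minimal length representing $w$). A braid move of length $m_{i,j}$ ($i\neq j$) replaces a consecutive factor $s_is_js_i\cdots$ of length $m_{i,j}$ in a word by the factor $s_js_is_j\cdots$ of length $m_{i,j}$; a commutation is a braid move with $m_{i,j}=2$. For a word $w=w_1\cdots w_m$ in $S$, $\operatorname{inv}(w)$ is the number of pairs $a<b$ with $w_b<w_a$, and the $S$-sign is $\sigma(w):=(-1)^{\operatorname{inv}(w)}$. The $T$-sign function is a function $\tau:\mathcal{R}(w)\to\{+1,-1\}$ such that whenever $x,x'\in\mathcal{R}(w)$ are related by a single braid move of length $m_{i,j}$ one has $\tau(x)=(-1)^{m_{i,j}-1}\tau(x')$. Such a function is known to exist and is unique up to global multiplication by $-1$. *)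

(* Defs.v *)
From HB Require Import structures.
From mathcomp Require Import all_boot all_order all_algebra all_fingroup.

Set Implicit Arguments.
Unset Strict Implicit.
Unset Printing Implicit Defensive.

(* The alphabet s_1 < ... < s_n is indexed by 'I_n, with the usual order on
   'I_n as its total order; words are sequences of indices.  In a Coxeter
   matrix the entry 0 stands for infinity. *)

Definition coxeter_matrix n (m : 'M[nat]_n) : Prop :=
  [/\ forall i, m i i = 1,
      forall i j, m i j = m j i &
      forall i j, i != j -> m i j != 1].

Definition word_prod (W : groupType) n (s : 'I_n -> W) (u : seq 'I_n) : W :=
  (\prod_(i <- u) s i)%g.

(* An entry 0 imposes no relation, since x ^+ 0 = 1. *)
Definition coxeter_relations (W : groupType) n (m : 'M[nat]_n)
    (s : 'I_n -> W) : Prop :=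
  forall i j, ((s i * s j) ^+ m i j = 1)%g.

(* W = < s_1, ..., s_n | (s_i s_j)^(m i j) = 1 >, as a universal property over
   all groups, finite or not.  The generation clause needs no inverses, as
   m i i = 1 makes every s i an involution. *)
Definition coxeter_system (W : groupType) n (m : 'M[nat]_n)
    (s : 'I_n -> W) : Prop :=
  [/\ coxeter_matrix m,
      coxeter_relations m s,
      forall x : W, exists u, word_prod s u = x &
      forall (H : groupType) (f : 'I_n -> H), coxeter_relations m f ->
        exists phi : {multiplicative W -> H}, forall i, phi (s i) = f i].

Definition coxeter_graph n (m : 'M[nat]_n) : rel 'I_n :=
  [rel i j | (i != j) && (m i j != 2)].

Definition coxeter_irreducible n (m : 'M[nat]_n) : Prop :=
  0 < n /\ forall i j, connect (coxeter_graph m) i j.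

Definition reduced_word (W : groupType) n (s : 'I_n -> W) (w : W)
    (u : seq 'I_n) : Prop :=
  word_prod s u = w /\ forall v, word_prod s v = w -> size u <= size v.

(* The word i j i ... of length k. *)
Definition alternating_word n (i j : 'I_n) (k : nat) : seq 'I_n :=
  mkseq (fun a => if odd a then j else i) k.

Definition braid_move n (m : 'M[nat]_n) (i j : 'I_n) (x y : seq 'I_n) : Prop :=
  [/\ i != j, 0 < m i j &
      exists p q, x = p ++ alternating_word i j (m i j) ++ q /\
                  y = p ++ alternating_word j i (m i j) ++ q].

Definition commutation n (m : 'M[nat]_n) (x y : seq 'I_n) : Prop :=
  exists i j, m i j = 2 /\ braid_move m i j x y.

Fixpoint related_by_commutations n (m : 'M[nat]_n) (k : nat)
    (u v : seq 'I_n) : Prop :=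
  if k is k'.+1 then
    exists x, commutation m u x /\ related_by_commutations m k' x v
  else u = v.

Definition inversions n (u : seq 'I_n) : nat :=
  #|[set ab : 'I_(size u) * 'I_(size u) |
      (ab.1 < ab.2) &&
      (tnth (in_tuple u) ab.2 < tnth (in_tuple u) ab.1)]|.

Definition S_sign n (u : seq 'I_n) : int := ((-1) ^+ inversions u)%R.

(* tau is a function on the reduced words of w only: it is represented by a
   function on all words whose values elsewhere are irrelevant. *)
Definition T_sign (W : groupType) n (m : 'M[nat]_n) (s : 'I_n -> W) (w : W)
    (tau : seq 'I_n -> int) : Prop :=
  (forall x, reduced_word s w x -> tau x = 1%R \/ tau x = (-1)%R) /\
  (forall x x' i j, reduced_word s w x -> reduced_word s w x' ->
     braid_move m i j x x' -> tau x = ((-1) ^+ (m i j - 1)%N * tau x')%R).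

(* Main.v *)
Require Import Defs.
From HB Require Import structures.
From mathcomp Require Import all_boot all_order all_algebra all_fingroup.

(** A commutation exchanges two adjacent distinct letters, so exactly one pair of positions changes
    its relative order and the parity of the inversion number flips ([odd_inversions_swap]). For
    [tau] the braid rule with [m i j = 2] gives the factor -1 directly, but it speaks of reduced
    words only; every intermediate word is reduced because a commutation preserves both product and
    length ([reduced_word_commutation]). Induction on [k] concludes. *)

Lemma inversions_sum n (x0 : 'I_n) (u : seq 'I_n) :
  inversions u = \sum_(a < size u) \sum_(b < size u)
                    ((a < b) && (nth x0 u b < nth x0 u a)).
Proof.
rewrite /inversions -sum1_card big_mkcond /= pair_bigA /=.
apply: eq_bigr => -[a b] _ /=.
by rewrite inE /= !(tnth_nth x0) /=; case: (_ && _).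
Qed.

(** This recursion replaces the count over pairs of positions and allows induction on a common
    prefix. *)
Lemma inversions_cons n (x : 'I_n) (u : seq 'I_n) :
  inversions (x :: u) = count (fun y : 'I_n => y < x) u + inversions u.
Proof.
rewrite !(inversions_sum _ x) /= big_ord_recl big_ord_recl /= add0n.
congr (_ + _).
  rewrite -sum1_count (big_nth x) big_mkord [RHS]big_mkcond.
  by apply: eq_bigr => a _; case: (_ < x).
by apply: eq_bigr => a _; rewrite big_ord_recl /= add0n.
Qed.

(** Each letter of [p] sees the same letters to its right, up to order, in both words, which reduces
    the claim to empty [p]. There [i] and [j] meet [q] alike, and exactly one of their two orders is
    an inversion. *)
Lemma odd_inversions_swap n (i j : 'I_n) (p q : seq 'I_n) :
  i != j ->
  odd (inversions (p ++ [:: i, j & q])) =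
    ~~ odd (inversions (p ++ [:: j, i & q])).
Proof.
move=> neq_ij; elim: p => [|x p IHp].
  rewrite !cat0s !inversions_cons /= !oddD !oddb.
  have : (i < j) = ~~ (j < i) by rewrite -leqNgt ltn_neqAle neq_ij.
  by move->; case: (j < i); do 3 case: (odd _).
rewrite !cat_cons !inversions_cons !oddD IHp addbN.
by congr (~~ (odd _ (+) _)); rewrite !count_cat /= (addnCA (i < x)).
Qed.

Lemma commutationP n (m : 'M[nat]_n) (u v : seq 'I_n) :
  commutation m u v ->
  exists i j p q, [/\ i != j, m i j = 2, braid_move m i j u v,
    u = p ++ [:: i, j & q] & v = p ++ [:: j, i & q]].
Proof.
move=> [i [j [mij huv]]]; have [neq_ij _ [p [q [eq_u eq_v]]]] := huv.
by exists i, j, p, q; split=> //; rewrite ?eq_u ?eq_v mij.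
Qed.

Lemma S_sign_commutation n (m : 'M[nat]_n) (u v : seq 'I_n) :
  commutation m u v -> S_sign u = (- S_sign v)%R.
Proof.
move=> /commutationP [i [j [p [q [neq_ij _ _ -> ->]]]]].
rewrite /S_sign -GRing.signr_odd odd_inversions_swap //.
by rewrite GRing.signrN GRing.signr_odd.
Qed.

Lemma word_prod_commutation (W : groupType) n (m : 'M[nat]_n) (s : 'I_n -> W)
    (u v : seq 'I_n) :
  coxeter_matrix m -> coxeter_relations m s -> commutation m u v ->
  word_prod s u = word_prod s v.
Proof.
move=> [m1 _ _] rel_s /commutationP [i [j [p [q [_ mij _ -> ->]]]]].
have ssV a : (s a)^-1%g = s a.
  by apply: mulg1_eq; have := rel_s a a; rewrite m1 expg1.
have comm_ij : (s i * s j = s j * s i)%g.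
  (* The product [s i * s j] is its own inverse, and the inverse is [s j * s i] since generators are
     involutions. *)
  have /mulg1_eq : (s i * s j * (s i * s j) = 1)%g.
    by have := rel_s i j; rewrite mij expg2.
  by rewrite invMg !ssV.
rewrite /word_prod !big_cat !big_cons /=; congr (_ * _)%g.
by rewrite !mulgA comm_ij.
Qed.

Lemma reduced_word_commutation (W : groupType) n (m : 'M[nat]_n)
    (s : 'I_n -> W) (w : W) (u v : seq 'I_n) :
  coxeter_matrix m -> coxeter_relations m s -> commutation m u v ->
  reduced_word s w u -> reduced_word s w v.
Proof.
move=> hm hs huv [prod_u min_u]; split.
  by rewrite -(word_prod_commutation _ _ _ _ _ _ hm hs huv).
have [i [j [p [q [_ _ _ eq_u ->]]]]] := commutationP _ _ _ _ huv.
by move=> x /min_u; rewrite eq_u !size_cat.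
Qed.

Theorem corollary1 (W : finGroupType) (n : nat) (m : 'M[nat]_n)
    (s : 'I_n -> W) (hWS : coxeter_system m s) (hirr : coxeter_irreducible m)
    (w : W) (tau : seq 'I_n -> int) (htau : T_sign m s w tau)
    (u v : seq 'I_n) (hu : reduced_word s w u) (hv : reduced_word s w v)
    (k : nat) (huv : related_by_commutations m k u v) :
  S_sign u = ((-1) ^+ k * S_sign v)%R /\ tau u = ((-1) ^+ k * tau v)%R.
Proof.
have [hm hs _ _] := hWS; have [_ tau_braid] := htau.
elim: k u hu huv => [|k IHk] u hu /=.
  by move=> ->; rewrite !GRing.expr0 !GRing.mul1r.
move=> [x [hux hxv]].
have hx := reduced_word_commutation _ _ _ _ _ _ _ hm hs hux hu.
have [Sx taux] := IHk x hx hxv.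
(* Folding the induction hypotheses back leaves only the sign change from [u] to [x]. *)
rewrite GRing.exprS -!GRing.mulrA !GRing.mulN1r -Sx -taux.
split; first exact: S_sign_commutation hux.
have [i [j [_ [_ [_ mij hbraid _ _]]]]] := commutationP _ _ _ _ hux.
by rewrite (tau_braid _ _ _ _ hu hx hbraid) mij GRing.expr1 GRing.mulN1r.
Qed.
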